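(* For $n\in\mathbb{N}\cup\{0\}$, \begin{align*} \sum_{m=0}^{n} \left[\begin{matrix} n\\ m\end{matrix}\right]_q \frac{(-\lambda/a;q)_m\,a^mq^{m(m+1)/2}}{(-bq;q)_m} = \frac{(-aq;q)_n}{(-bq;q)_n} \sum_{m=0}^{n} \left[\begin{matrix} n\\ m\end{matrix}\right]_q \frac{(-\lambda/b;q)_m\,b^mq^{m(m+1)/2}}{(-aq;q)_m}. \end{align*}
   Context: Here $|q|<1$, $(x;q)_0=1$, $(x;q)_n=(1-x)(1-xq)\cdots(1-xq^{n-1})$, and the Gaussian polynomial is $\left[\begin{matrix} N\\ n\end{matrix}\right]_q=\frac{(q;q)_N}{(q;q)_n(q;q)_{N-n}}$ if $0\le n\le N$ and $0$ otherwise. *)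

(* Defs.v *)
From HB Require Import structures.
From mathcomp Require Import all_boot all_order all_algebra.
Set Implicit Arguments.
Unset Strict Implicit.
Unset Printing Implicit Defensive.
Import GRing.Theory.
Local Open Scope ring_scope.

(* (x; q)_n *)
Definition qpoch (F : fieldType) (x q : F) (n : nat) : F :=
  \prod_(i < n) (1 - x * q ^+ i).

(* The quotient is the Gaussian polynomial only when (q; q)_N <> 0, which
   holds for |q| < 1; otherwise division by zero yields a junk value. *)
Definition gauss_binom (F : fieldType) (q : F) (N n : nat) : F :=
  if (n <= N)%N then qpoch q q N / (qpoch q q n * qpoch q q (N - n)) else 0.

(* Main.v *)
(** With both sides multiplied by [(-bq; q)_n] the identity says that
    [T_n(a, b; l) = sum_m [n, m] q^(m(m+1)/2) prod_(i < m) (a + l q^i)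
                    prod_(m <= i < n) (1 + b q^(i+1))]
    is symmetric in [a] and [b].  The Pascal rule and the [q]-difference of
    [T_n] in [b] combine into
    [T_(n+1)(a, b; l) = (1 + (a + b) q^(n+1)) T_n(a, b; l)
       + l q^(n+1) T_n(aq, bq; lq) - a b q^(n+2) (1 - q^n) T_(n-1)(aq, bq; lq)],
    whose coefficients are symmetric, so symmetry follows by induction on [n]. *)
Require Import Defs.
From HB Require Import structures.
From mathcomp Require Import all_boot all_order all_algebra.
From mathcomp Require Import reals complex.
From mathcomp Require Import ring zify.
Import Order.TTheory GRing.Theory Num.Theory.
Local Open Scope ring_scope.
Local Open Scope complex_scope.

Section QBinomial.
Variables (F : fieldType) (q : F).
Hypothesis q_nonroot : forall k, q ^+ k.+1 != 1.

Lemma qpoch0 (x : F) : qpoch x q 0 = 1.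
Proof. by rewrite /qpoch big_ord0. Qed.

Lemma qpochS (x : F) n : qpoch x q n.+1 = qpoch x q n * (1 - x * q ^+ n).
Proof. by rewrite /qpoch big_ord_recr. Qed.

Lemma qpochqS n : qpoch q q n.+1 = qpoch q q n * (1 - q ^+ n.+1).
Proof. by rewrite qpochS -exprS. Qed.

Lemma subr1X_neq0 k : 1 - q ^+ k.+1 != 0.
Proof. by rewrite subr_eq0 eq_sym. Qed.

Lemma qpochq_neq0 n : qpoch q q n != 0.
Proof.
elim: n => [|n IHn]; first by rewrite qpoch0 oner_neq0.
by rewrite qpochqS mulf_neq0 // subr1X_neq0.
Qed.

Lemma gauss_binom0 n : gauss_binom q n 0 = 1.
Proof. by rewrite /gauss_binom subn0 qpoch0 mul1r divff // qpochq_neq0. Qed.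

Lemma gauss_binom_small n m : (n < m)%N -> gauss_binom q n m = 0.
Proof. by rewrite /gauss_binom ltnNge => /negbTE ->. Qed.

(** Of the two Pascal rules, this one carries [q ^+ (n - m)], which merges with the [q ^+ m.+1] of
    [symsum_termSS] into a power free of [m]. *)
Lemma gauss_binom_pascal n m : (m <= n)%N ->
  gauss_binom q n.+1 m.+1 =
  gauss_binom q n m.+1 + q ^+ (n - m) * gauss_binom q n m.
Proof.
move=> le_mn; rewrite /gauss_binom ltnS le_mn subSS.
(* At [m = n] the upper term falls in the zero branch of [gauss_binom], so it is treated apart. *)
have [lt_mn | le_nm] := ltnP m n; last first.
  have -> : m = n by apply/eqP; rewrite eqn_leq le_mn le_nm.
  rewrite subnn expr0 mul1r add0r !qpoch0 !mulr1.
  by rewrite !divff // qpochq_neq0.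
have [k ->] : exists k, n = (m + k).+1.
  by exists (n - m.+1)%N; rewrite -addSn subnKC.
rewrite subSS -addnS !addKn addnS !qpochqS.
have := qpochq_neq0 m; have := qpochq_neq0 k.
have := subr1X_neq0 m; have := subr1X_neq0 k.
have -> : q ^+ (m + k).+2 = q ^+ m.+1 * q ^+ k.+1.
  by rewrite -exprD addSn addnS.
by move=> *; field; do ?[apply/andP; split].
Qed.

Lemma gauss_binom_mul n m : (m <= n)%N ->
  gauss_binom q n.+1 m * (1 - q ^+ (n.+1 - m)) =
  (1 - q ^+ n.+1) * gauss_binom q n m.
Proof.
move=> le_mn; rewrite /gauss_binom (leqW le_mn) le_mn subSn // !qpochqS.
have := qpochq_neq0 m; have := qpochq_neq0 (n - m).
have := subr1X_neq0 (n - m).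
by move=> *; field; do ?[apply/andP; split].
Qed.

(** Division-free form: [a ^+ m] is absorbed into the first product and the denominator is cleared,
    so [symsum] is the sum T_n(a, b; l). *)
Definition symsum_term (l a b : F) n m : F :=
  q ^+ (m * m.+1)./2 * (\prod_(0 <= i < m) (a + l * q ^+ i))
  * \prod_(m <= i < n) (1 + b * q ^+ i.+1).

Definition symsum (l a b : F) n : F :=
  \sum_(0 <= m < n.+1) gauss_binom q n m * symsum_term l a b n m.

Lemma triangular_half m : ((m.+1 * m.+2)./2 = (m * m.+1)./2 + m.+1)%N.
Proof. by rewrite (_ : m.+1 * m.+2 = m * m.+1 + m.+1.*2)%N; lia. Qed.

Lemma prod_shift (b : F) m n :
  \prod_(m.+1 <= i < n.+1) (1 + b * q ^+ i.+1) =
  \prod_(m <= i < n) (1 + b * q * q ^+ i.+1).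
Proof. by rewrite big_add1; apply: eq_bigr => i _; rewrite -mulrA -exprS. Qed.

(** Scaling [a] and [l] together pulls one [q] out of each factor, so a weight [q ^+ m] in a sum
    becomes a change of parameters. *)
Lemma symsum_term_scale (l a b : F) n m :
  symsum_term (l * q) (a * q) b n m = q ^+ m * symsum_term l a b n m.
Proof.
rewrite /symsum_term.
have -> : \prod_(0 <= i < m) (a * q + l * q * q ^+ i) =
          q ^+ m * \prod_(0 <= i < m) (a + l * q ^+ i).
  rewrite (eq_bigr (fun i => q * (a + l * q ^+ i))); last by move=> i _; ring.
  by rewrite big_split big_const_nat subn0 iter_mulr_1.
by ring.
Qed.

Lemma symsum_termSr (l a b : F) n m : (m <= n)%N ->
  symsum_term l a b n.+1 m = (1 + b * q ^+ n.+1) * symsum_term l a b n m.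
Proof. by move=> le_mn; rewrite /symsum_term big_nat_recr //=; ring. Qed.

Lemma symsum_termSS (l a b : F) n m :
  symsum_term l a b n.+1 m.+1 =
  q ^+ m.+1 * (a + l * q ^+ m) * symsum_term l a (b * q) n m.
Proof.
rewrite /symsum_term triangular_half exprD prod_shift big_nat_recr //=; ring.
Qed.

Lemma symsum_pascal (l a b : F) n :
  symsum l a b n.+1 =
  (1 + b * q ^+ n.+1) * symsum l a b n + a * q ^+ n.+1 * symsum l a (b * q) n
  + l * q ^+ n.+1 * symsum (l * q) (a * q) (b * q) n.
Proof.
transitivity (\sum_(0 <= m < n.+2) gauss_binom q n m * symsum_term l a b n.+1 m
  + \sum_(0 <= m < n.+1)
      q ^+ (n - m) * gauss_binom q n m * symsum_term l a b n.+1 m.+1).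
  rewrite /symsum !(@big_nat_recl _ _ _ n.+1) //= -addrA -big_split /=.
  rewrite !gauss_binom0; congr (_ + _); apply: eq_big_nat => m /andP[_ lt_mn].
  by rewrite gauss_binom_pascal // mulrDl.
rewrite -addrA; congr (_ + _).
  rewrite big_nat_recr //= gauss_binom_small // mul0r addr0 /symsum big_distrr.
  by apply: eq_big_nat => m /andP[_ lt_mn] /=; rewrite symsum_termSr //; ring.
rewrite /symsum !big_distrr -big_split /=.
apply: eq_big_nat => m /andP[_ lt_mn].
rewrite symsum_termSS symsum_term_scale.
have -> : q ^+ n.+1 = q ^+ (n - m) * q ^+ m.+1.
  by rewrite -exprD addnS subnK.
by ring.
Qed.

(** The two products over [b] and [b * q] differ only in one end factor, and those factors differ by
    [b * q ^+ m.+1 * (1 - q ^+ (n.+1 - m))]; [gauss_binom_mul] absorbs the last bracket. The term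
    [m = n.+1] is free of [b] and cancels. *)
Lemma symsum_qdiff (l a b : F) n :
  symsum l a b n.+1 - symsum l a (b * q) n.+1 =
  b * q * (1 - q ^+ n.+1) * symsum (l * q) (a * q) (b * q) n.
Proof.
rewrite /symsum -sumrB big_nat_recr //= /symsum_term !(@big_geq _ _ _ n.+1) //.
rewrite subrr addr0 big_distrr /=.
apply: eq_big_nat => m /andP[_ lt_mn].
rewrite -/(symsum_term (l * q) _ _ _ _).
rewrite symsum_term_scale.
have -> : b * q * (1 - q ^+ n.+1)
    * (gauss_binom q n m * (q ^+ m * symsum_term l a (b * q) n m)) =
  (1 - q ^+ n.+1) * gauss_binom q n m
    * (b * q * (q ^+ m * symsum_term l a (b * q) n m)) by ring.
rewrite -gauss_binom_mul // /symsum_term.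
rewrite (@big_ltn _ _ _ m n.+1) // prod_shift.
rewrite (@big_nat_recr _ _ _ n m) //=.
have -> : q ^+ n.+1 = q ^+ (n.+1 - m) * q ^+ m by rewrite -exprD subnK // ltnW.
by rewrite exprS; ring.
Qed.

Lemma symsum0 (l a b : F) : symsum l a b 0 = 1.
Proof.
by rewrite /symsum big_nat1 gauss_binom0 /symsum_term !big_geq // !mulr1.
Qed.

Lemma symsum_rec (l a b : F) n :
  symsum l a b n.+2 =
  (1 + (a + b) * q ^+ n.+2) * symsum l a b n.+1
  + l * q ^+ n.+2 * symsum (l * q) (a * q) (b * q) n.+1
  - a * b * q ^+ n.+3 * (1 - q ^+ n.+1) * symsum (l * q) (a * q) (b * q) n.
Proof.
rewrite symsum_pascal.
have -> : symsum l a (b * q) n.+1 = symsum l a b n.+1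
    - b * q * (1 - q ^+ n.+1) * symsum (l * q) (a * q) (b * q) n.
  by rewrite -symsum_qdiff subKr.
by rewrite (exprS q n.+2); ring.
Qed.

Lemma symsum_sym (l a b : F) n : symsum l a b n = symsum l b a n.
Proof.
(* The recurrence reaches back two steps and rescales the parameters, hence the paired, fully
   quantified hypothesis. *)
suff H k : forall l a b, symsum l a b k = symsum l b a k
    /\ symsum l a b k.+1 = symsum l b a k.+1 by case: (H n l a b).
elim: k {l a b} => [|k IHk] l a b.
  by split; rewrite ?symsum_pascal !symsum0 //; ring.
split; first by case: (IHk l a b).
rewrite !symsum_rec (IHk l a b).2.
by case: (IHk (l * q) (a * q) (b * q)) => -> ->; ring.
Qed.

Lemma qpoch_prod (b : F) n :
  qpoch (- b * q) q n = \prod_(0 <= i < n) (1 + b * q ^+ i.+1).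
Proof.
by rewrite /qpoch big_mkord; apply: eq_bigr => i _; rewrite exprS; ring.
Qed.

Lemma qpoch_divX (l a : F) m : a != 0 ->
  qpoch (- l / a) q m * a ^+ m = \prod_(0 <= i < m) (a + l * q ^+ i).
Proof.
move=> a0; rewrite big_mkord /qpoch.
rewrite -[X in a ^+ X]card_ord -prodr_const -big_split /=.
by apply: eq_bigr => i _; field.
Qed.

Lemma symsumE (l a b : F) n : a != 0 -> qpoch (- b * q) q n != 0 ->
  symsum l a b n = qpoch (- b * q) q n *
  \sum_(0 <= m < n.+1)
     gauss_binom q n m * (qpoch (- l / a) q m * a ^+ m * q ^+ (m * m.+1)./2)
     / qpoch (- b * q) q m.
Proof.
move=> a0; rewrite /symsum big_distrr /= => b0.
apply: eq_big_nat => m /andP[_ le_mn].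
rewrite qpoch_divX // /symsum_term; move: b0; rewrite !qpoch_prod.
(* Splitting the product at [m] shows that the denominator of index [m] divides the nonzero one of
   index [n]. *)
rewrite (@big_cat_nat _ _ _ m) //= mulf_eq0 negb_or => /andP[bm _].
by field.
Qed.

End QBinomial.

(* MathComp world *)
Theorem theorem2p5 (R : realType) (q a b lambda : R[i]) (n : nat)
  (hq : `|q| < 1) (ha : a != 0) (hb : b != 0)
  (haq : qpoch (- a * q) q n != 0) (hbq : qpoch (- b * q) q n != 0) :
  \sum_(0 <= m < n.+1)
     gauss_binom q n m
     * (qpoch (- lambda / a) q m * a ^+ m * q ^+ (m * m.+1)./2)
     / qpoch (- b * q) q m
  = qpoch (- a * q) q n / qpoch (- b * q) q n
    * \sum_(0 <= m < n.+1)
         gauss_binom q n m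
         * (qpoch (- lambda / b) q m * b ^+ m * q ^+ (m * m.+1)./2)
         / qpoch (- a * q) q m.
Proof.
(* Taking norms, [q ^+ k.+1 = 1] would contradict [|q| < 1]. *)
have q_nonroot k : q ^+ k.+1 != 1.
  apply/eqP => /(congr1 Num.norm) /eqP.
  by rewrite normrX normr1 lt_eqF // exprn_ilt1.
apply: (mulfI hbq); rewrite -symsumE // symsum_sym // symsumE //.
by rewrite mulrA [X in _ = X * _]mulrC divfK.
Qed.
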